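(* Let $G$ be a graph with a perfect matching and let $\{\{B_i\}_{i=1}^r,\{K_j\}_{j=1}^{\ell},R\}$ be a Deming decomposition of $G$. Then: (1) $\alpha(B_i)=\nu(B_i)-1$ for each $i\in\{1,\dots,r\}$; (2) $\alpha(K_j)=\nu(K_j)-1$ for each $j\in\{1,\dots,\ell\}$; (3) $\alpha(R)=\nu(R)$; (4) $\nu(G)=\sum_{i=1}^r\nu(B_i)+\sum_{j=1}^{\ell}\nu(K_j)+\nu(R)$; and (5) $\alpha(G)\le \nu(G)-(r+\ell)$.
   Context: Graphs are finite and simple. For a graph $H$, $n(H)$ is its order, $\alpha(H)$ its independence number and $\nu(H)$ its matching number. $H$ is KE (König-Egerváry) if $\alpha(H)+\nu(H)=n(H)$; the null graph is KE. $T$ is the graph on 6 vertices consisting of two vertex-disjoint triangles together with a single edge joining a vertex of one to a vertex of the other. An even subdivision of a graph is obtained by subdividing each edge an even number (possibly zero) of times, i.e. replacing each edge by a path of odd length. A Deming-$K_4$ graph is a graph $K$ that contains a spanning even subdivision of $K_4$ and such that $K-\{x,y\}$ (delete both vertices) is KE for every edge $xy$ of $K$ that lies in at least one perfect matching of $K$. A Deming-BP graph is a graph $B$ that contains a spanning even subdivision of $T$ and such that $B-\{x,y\}$ is KE for every edge $xy$ of $B$ that lies in at least one perfect matching of $B$. A Deming decomposition of a graph $G$ with a perfect matching consists of: a collection of Deming-BP subgraphs $\{B_i\}_{i=1}^r$ of $G$ ($r\ge 0$); a collection of Deming-$K_4$ subgraphs $\{K_j\}_{j=1}^{\ell}$ of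 $G$ ($\ell\ge 0$); and a KE subgraph $R$ of $G$ (possibly null) that has a perfect matching; such that the vertex sets of all these subgraphs partition $V(G)$. *)

(* Defs.v *)
From mathcomp Require Import all_boot.

Set Implicit Arguments.
Unset Strict Implicit.
Unset Printing Implicit Defensive.

(* A finite simple graph whose vertices are drawn from an ambient finite type,
   so that a graph and its subgraphs live in the same type. The vertex set may
   be empty (null graph). *)
Record sgraph (V : finType) := SGraph {
  vset : {set V};
  eset : {set {set V}};
  sgraphP : [forall e in eset, (e \subset vset) && (#|e| == 2)]
}.

Section Graphs.
Variable V : finType.
Implicit Types (G H : sgraph V) (S : {set V}) (M : {set {set V}}).

Definition subgraph H G := (vset H \subset vset G) && (eset H \subset eset G).

Lemma del_subproof G S :
  [forall e in [set e in eset G | [disjoint e & S]],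
     (e \subset vset G :\: S) && (#|e| == 2)].
Proof.
apply/forall_inP => e; rewrite inE => /andP[eG eS].
have /andP[eV ->] := forall_inP (sgraphP G) e eG.
by rewrite subsetD eV eS.
Qed.

(* G - S *)
Definition del G S : sgraph V := SGraph (del_subproof G S).

Definition order G := #|vset G|.

Definition independent G S :=
  (S \subset vset G) && [forall e in eset G, ~~ (e \subset S)].

Definition alpha G := \max_(S : {set V} | independent G S) #|S|.

Definition matching G M := (M \subset eset G) && trivIset M.

Definition nu G := \max_(M : {set {set V}} | matching G M) #|M|.

Definition perfect_matching G M := matching G M && (cover M == vset G).

Definition has_perfect_matching G := exists M, perfect_matching G M.

Definition KE G := alpha G + nu G = order G.

End Graphs.

(* H is obtained from F by replacing each edge by a path of odd length:
   f places the branch vertices, and p u v lists, from f u to f v, the internal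
   vertices of the path replacing the edge uv. That path has (size (p u v)).+1
   edges, hence odd length iff size (p u v) is even. *)
Definition even_subdivision (W V : finType) (F : sgraph W) (H : sgraph V) :=
  exists (f : W -> V) (p : W -> W -> seq V),
  let edge u v := [set u; v] \in eset F in
  [/\ {in vset F &, injective f},
      forall u v, edge u v ->
        [/\ p v u = rev (p u v), ~~ odd (size (p u v)), uniq (p u v)
          & [disjoint p u v & f @: vset F]],
      forall u v x y, edge u v -> edge x y -> [set u; v] != [set x; y] ->
        [disjoint p u v & p x y],
      forall z, z \in vset H <->
        z \in f @: vset F \/ exists u v, edge u v /\ z \in p u v
    & forall a b, [set a; b] \in eset H <->
        exists u v, edge u v /\ infix [:: a; b] (f u :: rcons (p u v) (f v))].

Lemma K4_subproof :
  [forall e in [set e : {set 'I_4} | #|e| == 2],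
     (e \subset [set: 'I_4]) && (#|e| == 2)].
Proof. by apply/forall_inP => e; rewrite inE subsetT. Qed.

Definition K4 : sgraph 'I_4 := SGraph K4_subproof.

(* Triangles {0,1,2} and {3,4,5}, joined by the edge {0,5}. *)
Definition T_edges : {set {set 'I_6}} :=
  let A := [set i : 'I_6 | i < 3] in
  [set e : {set 'I_6} | (#|e| == 2) &&
    [|| e \subset A, e \subset ~: A | e == [set ord0; ord_max]]].

Lemma T_subproof :
  [forall e in T_edges, (e \subset [set: 'I_6]) && (#|e| == 2)].
Proof. by apply/forall_inP => e; rewrite inE subsetT => /andP[]. Qed.

Definition T_graph : sgraph 'I_6 := SGraph T_subproof.

Section Deming.
Variable V : finType.
Implicit Types G H K B R : sgraph V.

Definition spanning_even_subdivision (W : finType) (F : sgraph W) G :=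
  exists H, [/\ subgraph H G, vset H = vset G & even_subdivision F H].

Definition KE_after_matched_edge_deletion G :=
  forall x y, [set x; y] \in eset G ->
    (exists M, perfect_matching G M /\ [set x; y] \in M) ->
    KE (del G [set x; y]).

Definition Deming_K4 K :=
  spanning_even_subdivision K4 K /\ KE_after_matched_edge_deletion K.

Definition Deming_BP B :=
  spanning_even_subdivision T_graph B /\ KE_after_matched_edge_deletion B.

(* Subgraphs need not be induced. The vertex set of R is allowed to be an empty
   block, hence pairwise disjointness rather than finset's [partition]. *)
Definition Deming_decomposition G (r l : nat)
    (B : 'I_r -> sgraph V) (K : 'I_l -> sgraph V) R :=
  let blocks := vset R :: [seq vset (B i) | i <- enum 'I_r]
                       ++ [seq vset (K j) | j <- enum 'I_l] in
  [/\ forall i, subgraph (B i) G /\ Deming_BP (B i),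
      forall j, subgraph (K j) G /\ Deming_K4 (K j),
      [/\ subgraph R G, KE R & has_perfect_matching R],
      pairwise (fun X Y : {set V} => [disjoint X & Y]) blocks
    & \bigcup_(X <- blocks) X = vset G].

End Deming.

(* Main.v *)
Require Import Defs.
From mathcomp Require Import all_boot all_order all_algebra.
From mathcomp Require Import zify.

(** A graph with a perfect matching has [nu] equal to half its order, so each
    identity between [alpha] and [nu] is a statement about how far the
    independence number falls below half the order, and the formula for [nu G]
    only says that the orders of the blocks add up to that of [G].  The bound
    on [alpha G] follows because an independent set of [G] restricts to an
    independent set of every block.

    What remains is that a Deming-BP or Deming-K4 graph [B] has a perfect
    matching and independence number exactly one less than half its order.

    Upper bound ([even_subdivision_deficient]).  Let [F] be K4 or T, let [H] be
    an even subdivision of [F], let [2 k_e] be the number of vertices inserted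
    on the edge [e], and let [S] be independent in [H].  Cutting the inserted
    vertices into consecutive pairs shows that [S] has at most [k_e] of them.
    If both ends of [e] are in [S], cutting the path together with its ends
    shows that [S] has at most [k_e - 1] of them.  So, if [A] is the set of the
    branch vertices in [S], then [S] has at most [|A| - e(A) + sum k_e]
    elements, with [e(A)] the number of edges of [F] inside [A].  A triangle
    or K4 satisfies [|A| - e(A) <= 1] for every [A]; hence
    [|A| - e(A) <= |F|/2 - 1] both for K4 and for T, which contains two
    disjoint triangles.  As [|H|/2 = |F|/2 + sum k_e], the bound follows, and
    it passes to [B] because [B] has more edges on the same vertices.
    The same pairs, taken with the ends along the edges of a perfect matching
    of [F] and without the ends along the other edges, form a perfect matching
    of [H], hence of [B].

    Lower bound ([deleted_edge_alpha]).  If [xy] is in a perfect matching of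
    [B], then [B - {x,y}] is KE and has a perfect matching, so it has an
    independent set with half of its vertices, that is [|B|/2 - 1], and this
    set is independent in [B]. *)

Set Implicit Arguments.
Unset Strict Implicit.
Unset Printing Implicit Defensive.

(* [order] would otherwise be the order of a point under a function. *)
Local Notation order := Defs.order.

(** * Sequences *)

Lemma uniq_flatten (T : eqType) (ss : seq (seq T)) :
  all uniq ss -> pairwise (fun s t => ~~ has (mem s) t) ss ->
  uniq (flatten ss).
Proof.
elim: ss => [|s ss IHss] //= /andP[us uss] /andP[dis pss].
rewrite cat_uniq us IHss // andbT /=.
apply/hasPn => x /flattenP[t tss xt].
by have /hasPn/(_ x xt) := allP dis t tss.
Qed.

Lemma sorted_infix2 (T : eqType) (e : rel T) (s : seq T) :
  (forall a b, infix [:: a; b] s -> e a b) -> sorted e s.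
Proof.
elim: s => [|x [|y s] IHs] //= H.
rewrite (H x y) ?eqxx ?prefix0s //=.
by apply: IHs => a b ab; apply: H; apply/orP; right.
Qed.

Lemma card_bigcup_disjoint (V : finType) (Xs : seq {set V}) :
  pairwise (fun X Y : {set V} => [disjoint X & Y]) Xs ->
  #|\bigcup_(X <- Xs) X| = \sum_(X <- Xs) #|X|.
Proof.
elim: Xs => [|X Xs IHXs] /=; first by rewrite !big_nil cards0.
case/andP=> dis pXs; rewrite !big_cons -IHXs //.
apply/eqP; rewrite (eq_leqif (leq_card_setU _ _)).
rewrite disjoints_subset big_seq.
elim/big_ind: _ => [|Y Z XY XZ|Y YXs]; first by rewrite setC0 subsetT.
  by rewrite setCU subsetI XY XZ.
by rewrite -disjoints_subset; exact: (allP dis).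
Qed.

Lemma card_setI_bigcup_le (V : finType) (S : {set V}) (Xs : seq {set V}) :
  #|S :&: \bigcup_(X <- Xs) X| <= \sum_(X <- Xs) #|S :&: X|.
Proof.
elim: Xs => [|X Xs IHXs]; first by rewrite !big_nil setI0 cards0.
rewrite !big_cons setIUr; apply: leq_trans (leq_card_setU _ _) _.
by rewrite leq_add2l.
Qed.

(** * Sequences cut into consecutive edges *)

Section Paired.
Variable V : finType.
Implicit Types (E M : {set {set V}}) (s t : seq V).

Fixpoint paired E s : bool :=
  match s with
  | [::] => true
  | [:: _] => false
  | x :: y :: s' => ([set x; y] \in E) && paired E s'
  end.

Lemma pair_ind (P : seq V -> Prop) :
  P [::] -> (forall x, P [:: x]) -> (forall x y s, P s -> P [:: x, y & s]) ->
  forall s, P s.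
Proof.
move=> P0 P1 P2 s; elim: {s}(size s) {-2}s (leqnn (size s)) => [|n IHn] s.
  by rewrite leqn0 size_eq0 => /eqP->.
case: s => [|x [|y s]] //= le_sn; apply: P2.
by apply: IHn; apply: ltnW.
Qed.

Lemma paired_cat E s t : paired E s -> paired E t -> paired E (s ++ t).
Proof.
by move=> + Et; elim/pair_ind: s => //= x y s IHs /andP[-> /IHs].
Qed.

Lemma paired_flatten E (ss : seq (seq V)) :
  all (paired E) ss -> paired E (flatten ss).
Proof. by elim: ss => //= s ss IHss /andP[Es /IHss]; exact: paired_cat. Qed.

Lemma sorted_paired E s :
  sorted (fun a b => [set a; b] \in E) s -> ~~ odd (size s) -> paired E s.
Proof.
elim/pair_ind: s => //= x y s IHs /andP[-> /path_sorted/IHs].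
by rewrite negbK; apply.
Qed.

Lemma paired_matching E s : paired E s -> uniq s ->
  exists M, [/\ M \subset E, trivIset M & cover M = [set x in s]].
Proof.
elim/pair_ind: s => //= [_ _|x y s IHs /andP[xyE sE]].
  exists set0; split; rewrite ?sub0set //; first by rewrite /trivIset /cover !big_set0 cards0.
  by rewrite /cover big_set0; apply/setP => z; rewrite !inE.
rewrite inE negb_or -andbA => /and4P[_ xs ys us].
have [M [ME tM cM]] := IHs sE us.
exists ([set [set x; y]] :|: M); split.
- by rewrite subUset sub1set xyE.
- apply: trivIsetU => //; first exact: trivIset1.
  rewrite cover1 cM disjoints_subset subUset !sub1set !inE.
  by rewrite xs ys.
- rewrite /cover bigcup_setU big_set1 -/(cover M) cM.
  by apply/setP => z; rewrite !inE orbA.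
Qed.

(** An independent set contains at most one end of each pair. *)
Lemma count_paired E s (S : {set V}) : paired E s ->
  {in E, forall e : {set V}, ~~ (e \subset S)} -> (count (mem S) s).*2 <= size s.
Proof.
move=> + ES; elim/pair_ind: s => //= x y s IHs /andP[/ES xyS /IHs].
move: xyS; rewrite subUset !sub1set.
by case: (x \in S) (y \in S) => [] [] //= _ le_s; lia.
Qed.

End Paired.

(** * Matchings and independent sets *)

Section Graphs.
Variable V : finType.
Implicit Types (G H B : sgraph V) (S : {set V}) (M : {set {set V}}).

Lemma eset_card2 G e : e \in eset G -> #|e| = 2.
Proof. by move/(forall_inP (sgraphP G)) => /andP[_ /eqP]. Qed.

Lemma eset_vset G e : e \in eset G -> e \subset vset G.
Proof. by move/(forall_inP (sgraphP G)) => /andP[]. Qed.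

Lemma card_cover_matching G M : matching G M -> #|cover M| = #|M|.*2.
Proof.
case/andP=> /subsetP MG /eqP <-.
rewrite (eq_bigr (fun=> 2)) => [|e /MG /eset_card2 //].
by rewrite sum_nat_const muln2.
Qed.

Lemma perfect_matching_nu G : has_perfect_matching G -> (nu G).*2 = order G.
Proof.
case=> M /andP[mM /eqP cM]; apply/eqP; rewrite eqn_leq; apply/andP; split.
  have := @eq_bigmax_cond _ (matching G) (fun N => #|N|).
  case=> [|N mN eqN]; first by apply/card_gt0P; exists M.
  rewrite /nu eqN -(card_cover_matching mN) subset_leq_card //.
  apply/bigcupsP => e eN; apply: eset_vset.
  by case/andP: mN => /subsetP/(_ e eN).
rewrite /order -cM (card_cover_matching mM) leq_double.
by rewrite /nu (leq_bigmax_cond M).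
Qed.

Lemma alpha_ge G S : independent G S -> #|S| <= alpha G.
Proof. by move=> iS; rewrite /alpha (leq_bigmax_cond S). Qed.

Lemma alpha_witness G : exists2 S, independent G S & #|S| = alpha G.
Proof.
have [|S iS eqS] := @eq_bigmax_cond _ (independent G) (fun S => #|S|).
  apply/card_gt0P; exists set0; rewrite unfold_in sub0set /=.
  apply/forall_inP => e /eset_card2 e2.
  by rewrite subset0 -cards_eq0 e2.
by exists S; last exact: esym eqS.
Qed.

Lemma independent_subgraph H G S :
  subgraph H G -> independent G S -> independent H (S :&: vset H).
Proof.
case/andP=> _ /subsetP eHG /andP[_ /forall_inP iS].
rewrite /independent subsetIr /=; apply/forall_inP => e /eHG /iS.
by apply: contra => /subset_trans; apply; exact: subsetIl.
Qed.

Lemma independent_del G S D : independent (del G D) S -> independent G S.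
Proof.
case/andP; rewrite subsetD => /andP[SG SD] /forall_inP iS.
rewrite /independent SG; apply/forall_inP => e eG; apply/negP => eS.
suff /iS/negP : e \in eset (del G D) by [].
by rewrite inE eG (disjointWl eS SD).
Qed.

Lemma perfect_matching_del G M e : perfect_matching G M -> e \in M ->
  perfect_matching (del G e) (M :\ e).
Proof.
case/andP=> /andP[/subsetP MG tM] /eqP cM eM.
have dis g : g \in M -> g != e -> [disjoint g & e].
  by move=> gM; apply: (trivIsetP tM).
rewrite /perfect_matching /matching; apply/andP; split.
  rewrite (trivIsetS (subsetDl M [set e]) tM) andbT.
  by apply/subsetP => g /setD1P[ge gM]; rewrite inE MG ?dis.
rewrite eqEsubset /= subsetD -cM; apply/andP; split.
  apply/andP; split.
    by apply/bigcupsP => g /setD1P[_ gM]; exact: bigcup_sup.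
  rewrite disjoints_subset; apply/bigcupsP => g /setD1P[ge gM].
  by rewrite -disjoints_subset dis.
apply/subsetP => x /setDP[/bigcupP[g gM xg] xe].
apply/bigcupP; exists g => //; rewrite !inE gM andbT.
by apply: contra xe => /eqP <-.
Qed.

(** An independent set of half the vertices survives the deletion of a matched
    edge, and it is independent in [G] since no edge of [G] inside it meets the
    deleted edge. *)
Lemma deleted_edge_alpha G : 0 < order G -> has_perfect_matching G ->
  KE_after_matched_edge_deletion G -> nu G <= (alpha G).+1.
Proof.
move=> G0 pG keG; have nuG := perfect_matching_nu pG.
case: pG => M pM; have /andP[/andP[/subsetP MG _] /eqP cM] := pM.
have [v vG] : exists v, v \in vset G by apply/card_gt0P.
move: vG; rewrite -cM => /bigcupP[e eM _].
have e2 := eset_card2 (MG e eM).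
have /cards2P[x [y [_ exy]]] := introT eqP e2.
have pD := perfect_matching_del pM eM.
have nuD : (nu (del G e)).*2 = order (del G e).
    by apply: perfect_matching_nu; exists (M :\ e).
have keD : KE (del G e).
  by rewrite exy; apply: keG; rewrite -exy; [exact: MG | exists M].
have ordD : order (del G e) + 2 = order G.
  have /setIidPr eG := eset_vset (MG e eM).
  by rewrite /order /= -(cardsID e (vset G)) eG e2 addnC.
have [S /independent_del/alpha_ge leS eqS] := alpha_witness (del G e).
by move: keD; rewrite /KE; lia.
Qed.

End Graphs.

(** * Even subdivisions *)

Section Subdivision.
Variables (W V : finType) (F : sgraph W).

Definition ends (M : seq (W * W)) : seq W := flatten [seq [:: e.1; e.2] | e <- M].

(** A certificate that can be checked by computation for a concrete [F].  Edges
    come as oriented pairs, so that each subdivided edge is counted once; the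
    matching [M] serves also as the list of vertices, and [size M] as [|F|/2],
    so the last condition reads [|A| - e(A) < |F|/2]. *)
Definition deficient_presentation (M N : seq (W * W)) :=
  [/\ forall u v, [set u; v] \in eset F ->
        ((u, v) \in M ++ N) || ((v, u) \in M ++ N),
      {in M ++ N, forall e : W * W, [set e.1; e.2] \in eset F},
      uniq [seq [set e.1; e.2] | e <- M ++ N],
      uniq (ends M) /\ ends M =i vset F
    & forall A : pred W,
        count A (ends M) < count (fun e => A e.1 && A e.2) (M ++ N) + size M].

(** The two bounds on a path, one with its ends and one without, add up over
    the edges of [F]; the pairs that prove them give the perfect matching. *)
Lemma even_subdivision_deficient (M N : seq (W * W)) (H : sgraph V) :
  deficient_presentation M N -> even_subdivision F H ->
  has_perfect_matching H /\ ((alpha H).+1).*2 <= order H.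
Proof.
case=> edgeMN MNedge uMN [uM Mall] defic [f [p [f_inj p_edge p_dis vH eH]]].
set E := M ++ N in edgeMN MNedge uMN defic.
pose q (e : W * W) := p e.1 e.2.
pose full (e : W * W) := f e.1 :: rcons (q e) (f e.2).
have full_sorted e : e \in E ->
    sorted (fun a b => [set a; b] \in eset H) (full e).
  move=> eE; apply: sorted_infix2 => a b ab; apply/eH.
  by exists e.1, e.2; split=> //; exact: MNedge.
have q_even e : e \in E -> ~~ odd (size (q e)).
  by move=> /MNedge/p_edge[].
have q_uniq e : e \in E -> uniq (q e).
  by move=> /MNedge/p_edge[].
have full_paired e : e \in E -> paired (eset H) (full e).
  move=> eE; apply: sorted_paired (full_sorted e eE) _.
  by rewrite /= size_rcons /= negbK q_even.
have q_paired e : e \in E -> paired (eset H) (q e).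
  move=> eE; apply: sorted_paired (q_even e eE).
  have := full_sorted e eE; rewrite /full /= rcons_path => /andP[].
  by move=> /path_sorted.
pose L := flatten [seq full e | e <- M] ++ flatten [seq q e | e <- N].
pose L' := map f (ends M) ++ flatten [seq q e | e <- E].
have permL : perm_eq L L'.
  rewrite /L /L' /E map_cat flatten_cat catA perm_cat2r.
  apply/permP => a; elim: (M) => //= e M' IHM.
  move: IHM; rewrite !count_cat /= -cats1 !count_cat /= /ends => ->; lia.
have uL' : uniq L'.
  rewrite /L' cat_uniq; apply/and3P; split.
  - rewrite map_inj_in_uniq // => x y; rewrite !Mall; exact: f_inj.
  - apply/hasPn => x /flattenP[_ /mapP[e eE ->]] xe.
    have [_ _ _ dis] := p_edge _ _ (MNedge e eE).
    apply/negP => /mapP[w]; rewrite Mall => wF xw.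
    by have := disjointFr dis xe; rewrite xw imset_f.
  - apply: uniq_flatten; first by apply/allP => _ /mapP[e eE ->]; exact: q_uniq.
    rewrite pairwise_map; move: uMN; rewrite uniq_pairwise pairwise_map.
    apply: (@sub_in_pairwise _ (mem E)); last by apply/allP.
    move=> e g eE gE /= neq; apply/hasPn => x xg; apply/negP => xe.
    have dis := p_dis _ _ _ _ (MNedge e eE) (MNedge g gE) neq.
    by have := disjointFr dis xe; rewrite xg.
have memL : L' =i vset H.
  move=> z; apply/idP/idP.
    rewrite mem_cat => /orP[/mapP[w wM ->]|/flattenP[_ /mapP[e eE ->] ze]].
      by apply/vH; left; rewrite imset_f // -Mall.
    by apply/vH; right; exists e.1, e.2; split=> //; exact: MNedge.
  rewrite mem_cat => /vH[/imsetP[w wF ->]|[u [v [uvF zp]]]].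
    by rewrite map_f // Mall.
  apply/orP; right; apply/flattenP.
  have [uvE|vuE] := orP (edgeMN u v uvF).
    by exists (q (u, v)); [exact: map_f | ].
  exists (q (v, u)); first exact: map_f.
  by rewrite /q /=; have [-> _ _ _] := p_edge u v uvF; rewrite mem_rev.
have sizeL : order H = (size M).*2 + size (flatten [seq q e | e <- E]).
  rewrite /order -(eq_card memL) (card_uniqP uL') size_cat size_map.
  congr (_ + _); rewrite /ends; elim: (M) => //= e M' ->; lia.
split.
  have Lp : paired (eset H) L.
    apply: paired_cat; apply: paired_flatten; apply/allP => _ /mapP[e eM ->].
      by apply: full_paired; rewrite mem_cat eM.
    by apply: q_paired; rewrite mem_cat eM orbT.
  have [M0 [M0H tM0 cM0]] := paired_matching Lp (etrans (perm_uniq permL) uL').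
  exists M0; rewrite /perfect_matching /matching M0H tM0 cM0 /=.
  by apply/eqP/setP => z; rewrite inE (perm_mem permL) memL.
have [S /andP[SH /forall_inP iS] <-] := alpha_witness H.
have cardS : #|S| = count (mem S) L'.
  rewrite -size_filter -(card_uniqP (filter_uniq (mem S) uL')).
  apply: eq_card => z; rewrite mem_filter memL /= [in RHS]andbC.
  by case: (boolP (z \in S)) => [/(subsetP SH) ->|_]; rewrite ?andbF.
pose A : pred W := fun w => f w \in S.
have paths : (count (mem S) (flatten [seq q e | e <- E])
     + count (fun e => A e.1 && A e.2) E).*2
   <= size (flatten [seq q e | e <- E]).
  have : all (mem E) E by apply/allP.
  (* The outer [E] of the hypothesis stays fixed, so that every edge of the
     shrinking list is still known to be an edge of [F]. *)
  elim: {2 3 4 5}E => //= e E' IHE /andP[eE /IHE].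
  have := count_paired (full_paired e eE) iS.
  have := count_paired (q_paired e eE) iS.
  rewrite /full /= size_rcons -cats1 !count_cat size_cat /= -/(A e.1) -/(A e.2).
  by case: (A e.1) (A e.2) => [] []; lia.
have := defic A.
rewrite cardS /L' count_cat count_map -/A sizeL => lt_A.
have -> : count (preim f (mem S)) (ends M) = count A (ends M) by [].
lia.
Qed.

End Subdivision.

(** Sharpness comes from a matched edge: deleting it leaves a KE graph that
    has a perfect matching. *)
Lemma deficient_block (W V : finType) (F : sgraph W) (M N : seq (W * W))
    (B : sgraph V) :
  deficient_presentation F M N -> spanning_even_subdivision F B ->
  KE_after_matched_edge_deletion B ->
  has_perfect_matching B /\ nu B = (alpha B).+1.
Proof.
move=> presF [H [HB vHB subH]] keB.
have [[M0 /andP[/andP[M0H tM0] cM0]] leH] :=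
  even_subdivision_deficient presF subH.
have pB : has_perfect_matching B.
  exists M0; rewrite /perfect_matching /matching tM0 -vHB cM0 !andbT.
  by apply: subset_trans M0H _; case/andP: HB.
have leBH : alpha B <= alpha H.
  have [S iS <-] := alpha_witness B.
  have := alpha_ge (independent_subgraph HB iS).
  by rewrite vHB; case/andP: iS => /setIidPl ->.
have ordBH : order H = order B by rewrite /order vHB.
have nuB := perfect_matching_nu pB.
have geB : nu B <= (alpha B).+1.
  by apply: deleted_edge_alpha => //; lia.
by split=> //; lia.
Qed.

(** * The graphs K4 and T *)

Section Presentations.
Let k i (lt_i4 : i < 4) : 'I_4 := Ordinal lt_i4.
Let t i (lt_i6 : i < 6) : 'I_6 := Ordinal lt_i6.

Lemma K4_presentation : exists M N, deficient_presentation K4 M N.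
Proof.
pose v0 := @k 0 isT; pose v1 := @k 1 isT; pose v2 := @k 2 isT.
pose v3 := @k 3 isT.
exists [:: (v0, v1); (v2, v3)], [:: (v0, v2); (v0, v3); (v1, v2); (v1, v3)].
split.
- move=> u v; rewrite inE cards2.
  by case: u v => [[|[|[|[|?]]]] ?] [[|[|[|[|?]]]] ?].
- by apply/allP; rewrite /= !inE !cards2.
- by rewrite /= !inE !eqEsubset !subUset !sub1set !inE.
- by split=> // u; rewrite in_setT; case: u => [[|[|[|[|?]]]] ?].
- by move=> A /=; case: (A v0); case: (A v1); case: (A v2); case: (A v3).
Qed.

Lemma T_presentation : exists M N, deficient_presentation T_graph M N.
Proof.
pose v0 := @t 0 isT; pose v1 := @t 1 isT; pose v2 := @t 2 isT.
pose v3 := @t 3 isT; pose v4 := @t 4 isT; pose v5 := @t 5 isT.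
exists [:: (v1, v2); (v3, v4); (v0, v5)],
  [:: (v0, v1); (v0, v2); (v3, v5); (v4, v5)].
split.
- move=> u v; rewrite inE cards2 eqEsubset !subUset !sub1set !inE.
  by case: u v => [[|[|[|[|[|[|?]]]]]] ?] [[|[|[|[|[|[|?]]]]]] ?].
- apply/allP; rewrite /= !inE !cards2 !eqEsubset !subUset !sub1set.
  by rewrite !inE.
- by rewrite /= !inE !eqEsubset !subUset !sub1set !inE.
- by split=> // u; rewrite in_setT; case: u => [[|[|[|[|[|[|?]]]]]] ?].
- move=> A /=; case: (A v0); case: (A v1); case: (A v2);
  by case: (A v3); case: (A v4); case: (A v5).
Qed.

End Presentations.

(** * Deming decompositions *)

Theorem theorem3p1 (V : finType) (G : sgraph V) (r l : nat)
    (B : 'I_r -> sgraph V) (K : 'I_l -> sgraph V) (R : sgraph V)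
    (hG : has_perfect_matching G)
    (hD : Deming_decomposition G B K R) :
  [/\ forall i : 'I_r, ((alpha (B i))%:Z = (nu (B i))%:Z - 1)%R,
      forall j : 'I_l, ((alpha (K j))%:Z = (nu (K j))%:Z - 1)%R,
      alpha R = nu R,
      nu G = (\sum_(i < r) nu (B i) + \sum_(j < l) nu (K j) + nu R)%N
    & ((alpha G)%:Z <= (nu G)%:Z - (r + l)%N%:Z)%R].
Proof.
case: hD => hB hK [RG keR pR] disj cov.
set blocks := _ :: _ in disj cov.
have sum_blocks (g : {set V} -> nat) : \sum_(X <- blocks) g X =
    g (vset R) + (\sum_(i < r) g (vset (B i)) + \sum_(j < l) g (vset (K j))).
  rewrite big_cons big_cat 2!big_map !big_enum /=.
  by congr (_ + (_ + _)); apply: eq_bigl => i; rewrite inE.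
have [MT [NT presT]] := T_presentation; have [M4 [N4 pres4]] := K4_presentation.
have defB i : has_perfect_matching (B i) /\ nu (B i) = (alpha (B i)).+1.
  by have [_ [sB keB]] := hB i; exact: deficient_block presT sB keB.
have defK j : has_perfect_matching (K j) /\ nu (K j) = (alpha (K j)).+1.
  by have [_ [sK keK]] := hK j; exact: deficient_block pres4 sK keK.
have nuR := perfect_matching_nu pR.
have alR : alpha R = nu R by move: keR; rewrite /KE; lia.
have nuG : nu G = (\sum_(i < r) nu (B i) + \sum_(j < l) nu (K j) + nu R)%N.
  have := card_bigcup_disjoint disj; rewrite cov sum_blocks.
  rewrite -[#|vset G|]/(order G) -(perfect_matching_nu hG).
  rewrite -[#|vset R|]/(order R) -nuR.
  rewrite (eq_bigr (fun i => 2 * nu (B i))); last first.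
    by move=> i _; rewrite mul2n perfect_matching_nu //; case: (defB i).
  rewrite [X in _ + (_ + X)](eq_bigr (fun j => 2 * nu (K j))); last first.
    by move=> j _; rewrite mul2n perfect_matching_nu //; case: (defK j).
  by rewrite -!big_distrr /=; lia.
have alG : alpha G <=
    alpha R + (\sum_(i < r) alpha (B i) + \sum_(j < l) alpha (K j)).
  have [S iS <-] := alpha_witness G.
  have le_block H : subgraph H G -> #|S :&: vset H| <= alpha H.
    by move=> HG; apply/alpha_ge/(independent_subgraph HG).
  have /setIidPl eqS : S \subset vset G by case/andP: iS.
  rewrite -eqS -cov; apply: leq_trans (card_setI_bigcup_le _ _) _.
  rewrite sum_blocks; apply: leq_add; first exact: le_block.
  by apply: leq_add; apply: leq_sum => i _; apply: le_block;
    [case: (hB i) | case: (hK i)].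
have sumB : \sum_(i < r) nu (B i) = \sum_(i < r) alpha (B i) + r.
  rewrite (eq_bigr (fun i => alpha (B i) + 1)) => [|i _].
    by rewrite big_split /= sum_nat_const card_ord muln1.
  by rewrite addn1; case: (defB i).
have sumK : \sum_(j < l) nu (K j) = \sum_(j < l) alpha (K j) + l.
  rewrite (eq_bigr (fun j => alpha (K j) + 1)) => [|j _].
    by rewrite big_split /= sum_nat_const card_ord muln1.
  by rewrite addn1; case: (defK j).
split=> // [i|j|]; [have [_] := defB i | have [_] := defK j | ]; lia.
Qed.
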